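(* Let $(G,B,m,w)$ be a weighted finite graph with boundary. Then: (1) for any $i=1,2,\dots,|\Omega|$ and $j=0,1,\dots,|\Omega|-i$, $$\lambda_i\le\mu_{i+j}(\Omega)+\operatorname{Deg}_B^{(|\Omega|-j)},$$ with equality for a pair $i,j$ if and only if there is a nonzero function $u\in\mathbb{R}^\Omega$ such that $\Delta^Du=\lambda_iu$, $\Delta_\Omega u=\mu_{i+j}(\Omega)u$ and $\operatorname{Deg}_B\cdot u=\operatorname{Deg}_B^{(|\Omega|-j)}u$; (2) for any $i=1,2,\dots,|\Omega|$ and $j=1,2,\dots,i$, $$\lambda_i\ge\mu_{i-j+1}(\Omega)+\operatorname{Deg}_B^{(j)},$$ with equality for a pair $i,j$ if and only if there is a nonzero function $u\in\mathbb{R}^\Omega$ such that $\Delta^Du=\lambda_iu$, $\Delta_\Omega u=\mu_{i-j+1}(\Omega)u$ and $\operatorname{Deg}_B\cdot u=\operatorname{Deg}_B^{(j)}u$. Here $\operatorname{Deg}_B^{(1)}\le\operatorname{Deg}_B^{(2)}\le\dots\le\operatorname{Deg}_B^{(|\Omega|)}$ is the nondecreasing rearrangement of the values $\operatorname{Deg}_B(x)$, $x\in\Omega$.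
   Context: A weighted finite graph $(G,m,w)$ is a finite simple graph $G$ with vertex set $V$ and edge set $E$, a vertex-measure $m:V\to(0,\infty)$ and an edge-weight $w:E\to(0,\infty)$; $w$ is extended to a symmetric function on $V\times V$ by $w_{xy}=0$ when $\{x,y\}\notin E$. A weighted finite graph with boundary $(G,B,m,w)$ is a weighted finite graph with a nonempty subset $B\subset V$ (the boundary); $\Omega=V\setminus B$ is the interior. $\mathbb{R}^S$ is the space of real functions on $S$, with inner product $\langle u,v\rangle_S=\sum_{x\in S}u(x)v(x)m_x$. For $x\in\Omega$, $\operatorname{Deg}_B(x)=\frac1{m_x}\sum_{y\in B}w_{xy}$, and $\operatorname{Deg}_B\cdot u$ is the pointwise product. Laplacian: $\Delta u(x)=\frac1{m_x}\sum_{y\in V}(u(x)-u(y))w_{xy}$ for $u\in\mathbb{R}^V$. Laplacian of the interior subgraph: $\Delta_\Omega u(x)=\frac1{m_x}\sum_{y\in\Omega}(u(x)-u(y))w_{xy}$ for $u\in\mathbb{R}^\Omega$, with eigenvalues, counted with multiplicity, $0=\mu_1(\Omega)\le\dots\le\mu_{|\Omega|}(\Omega)$. Dirichlet Laplacian: for $u\in\mathbb{R}^\Omega$ let $E_0(u)\in\mathbb{R}^V$ be its extension by $0$ on $B$, and $\Delta^Du=(\Delta E_0(u))|_\Omega$. This is a nonnegative self-adjoint operator on $\mathbb{R}^\Omega$ with eigenvalues (the Dirichlet eigenvalues), counted with multiplicity, $0\le\lambda_1\le\dots\le\lambda_{|\Omega|}$. *)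

(* Defs.v *)
From HB Require Import structures.
From mathcomp Require Import all_boot all_order all_algebra.
From mathcomp Require Import polyrcf.
From mathcomp Require Import reals.

Set Implicit Arguments.
Unset Strict Implicit.
Unset Printing Implicit Defensive.

Import Order.TTheory GRing.Theory Num.Theory.
Import passmx.

Local Open Scope ring_scope.

(* The edge weight is stored already extended by 0 to V * V. *)
Record weighted_graph (R : realType) (V : finType) := WeightedGraph {
  edge : rel V;
  edge_sym : symmetric edge;
  edge_irr : irreflexive edge;
  vmeas : V -> R;
  vmeas_gt0 : forall x, 0 < vmeas x;
  weight : V -> V -> R;
  weight_sym : forall x y, weight x y = weight y x;
  weight_gt0 : forall x y, edge x y -> 0 < weight x y;
  weight_eq0 : forall x y, ~~ edge x y -> weight x y = 0
}.

(* R^S; the codomain is the regular module R^o so that R^S is a vectType. *)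
Definition rfun (R : realType) (S : finType) : vectType R := {ffun S -> R^o}.

Definition interior (V : finType) (B : {set V}) : finType :=
  {x : V | x \notin B}.

Fact weighted_sum_is_linear (R : realType) (I : finType) (c a s t : R)
    (f g k : I -> R) :
  c * (\sum_y (a * s + t - (a * f y + g y)) * k y) =
  a * (c * (\sum_y (s - f y) * k y)) + c * (\sum_y (t - g y) * k y).
Proof.
suff -> : \sum_y (a * s + t - (a * f y + g y)) * k y =
  a * (\sum_y (s - f y) * k y) + \sum_y (t - g y) * k y.
  by rewrite mulrDr mulrCA.
rewrite mulr_sumr -big_split; apply: eq_bigr => y _ /=.
by rewrite mulrA -mulrDl mulrBr opprD addrACA.
Qed.

Section Operators.
Context {R : realType} {V : finType}.
Variables (G : weighted_graph R V) (B : {set V}).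
Local Notation Omega := (interior B).
Local Notation m := (vmeas G).
Local Notation w := (weight G).

Definition laplacian (u : rfun R V) : rfun R V :=
  [ffun x => (m x)^-1 * (\sum_(y : V) ((u x : R) - u y) * w x y) : R].

Definition ext0 (u : rfun R Omega) : rfun R V :=
  [ffun x => if insub x is Some z then u z else 0].

Definition restr (v : rfun R V) : rfun R Omega := [ffun x => v (val x)].

Definition dirichlet_laplacian (u : rfun R Omega) : rfun R Omega :=
  restr (laplacian (ext0 u)).

Definition interior_laplacian (u : rfun R Omega) : rfun R Omega :=
  [ffun x => (m (val x))^-1 *
             (\sum_(y : Omega) ((u x : R) - u y) * w (val x) (val y)) : R].

Definition degB (x : Omega) : R :=
  (m (val x))^-1 * \sum_(y in B) w (val x) y.

Definition degB_mul (u : rfun R Omega) : rfun R Omega :=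
  [ffun x => degB x * u x : R].

Fact laplacian_is_linear : linear laplacian.
Proof.
move=> a u v; apply/ffunP => x; rewrite !ffunE.
under eq_bigr do rewrite !ffunE.
exact: weighted_sum_is_linear.
Qed.

Fact ext0_is_linear : linear ext0.
Proof.
move=> a u v; apply/ffunP => x; rewrite !ffunE.
by case: insubP => [z _ _|_]; rewrite ?ffunE // scaler0 addr0.
Qed.

Fact restr_is_linear : linear restr.
Proof. by move=> a u v; apply/ffunP => x; rewrite !ffunE. Qed.

Fact dirichlet_laplacian_is_linear : linear dirichlet_laplacian.
Proof.
move=> a u v; rewrite /dirichlet_laplacian.
by rewrite ext0_is_linear laplacian_is_linear restr_is_linear.
Qed.

Fact interior_laplacian_is_linear : linear interior_laplacian.
Proof.
move=> a u v; apply/ffunP => x; rewrite !ffunE.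
under eq_bigr do rewrite !ffunE.
exact: weighted_sum_is_linear.
Qed.

HB.instance Definition _ := GRing.isLinear.Build R (rfun R Omega) (rfun R Omega)
  _ dirichlet_laplacian dirichlet_laplacian_is_linear.
HB.instance Definition _ := GRing.isLinear.Build R (rfun R Omega) (rfun R Omega)
  _ interior_laplacian interior_laplacian_is_linear.

End Operators.

Section Eigenvalues.
Context {R : realType} {U : vectType R}.
Implicit Types f : 'End(U).

Definition lchar_poly f : {poly R} :=
  char_poly (mxof (vbasis {:U}) (vbasis {:U}) f).

(* The real eigenvalues in nondecreasing order, each repeated according to the
   dimension of its eigenspace; rootsR lists the distinct real roots of a
   polynomial in increasing order.  For a self-adjoint operator, geometric and
   algebraic multiplicities agree and the list has length dim U.  The
   specification is count_eigenvalues and eigenvalues_sorted below. *)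
Definition eigenvalues f : seq R :=
  flatten [seq nseq (\dim (leigenspace f a)) a | a <- rootsR (lchar_poly f)].

Lemma root_lchar_poly f a : root (lchar_poly f) a = leigenvalue f a.
Proof.
have e_basis := vbasisP {:U}.
rewrite -eigenvalue_root_char /leigenvalue (leigenspaceE e_basis) /eigenvalue.
by rewrite -(vsof_eq0 e_basis).
Qed.

Lemma count_eigenvalues f a :
  count_mem a (eigenvalues f) = \dim (leigenspace f a).
Proof.
have p0 : lchar_poly f != 0 by rewrite monic_neq0 // char_poly_monic.
have ur : uniq (rootsR (lchar_poly f)).
  exact: (sorted_uniq lt_trans ltxx (sorted_roots _ _ _)).
have -> : \dim (leigenspace f a) =
    ((a \in rootsR (lchar_poly f)) * \dim (leigenspace f a))%N.
  have := roots_on_rootsR p0 a; rewrite in_itv /= root_lchar_poly => <-.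
  by rewrite /leigenvalue; case: eqVneq => [->|_]; rewrite ?dimv0 ?mul1n.
rewrite /eigenvalues; elim: (rootsR _) ur => [|b s IHs] //= /andP[bs us].
rewrite count_cat count_nseq IHs // in_cons /= eq_sym.
have [->|_] //= := eqVneq a b.
by rewrite (negbTE bs) mul0n addn0.
Qed.

Lemma eigenvalues_sorted f : sorted <=%R (eigenvalues f).
Proof.
have : sorted <%R (rootsR (lchar_poly f)) := sorted_roots _ _ _.
rewrite lt_sorted_pairwise le_sorted_pairwise /eigenvalues.
elim: (rootsR _) => [|b s IHs] //= /andP[bs ss].
rewrite pairwise_cat IHs // andbT; apply/andP; split.
  apply/allrelP => x y /nseqP[-> _] /flatten_mapP[c cs /nseqP[-> _]].
  exact/ltW/(allP bs).
by elim: (\dim _) => //= n ->; rewrite andbT; apply/allP => x /nseqP[-> _].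
Qed.

End Eigenvalues.

(* 1-based indexing of finite nondecreasing sequences. *)
Definition item1 (R : realType) (s : seq R) (k : nat) : R := s`_k.-1.

Section Spectra.
Context {R : realType} {V : finType}.
Variables (G : weighted_graph R V) (B : {set V}).

Definition dirichlet_eigenvalue (i : nat) : R :=
  item1 (eigenvalues (linfun (dirichlet_laplacian G (B := B)))) i.

Definition interior_eigenvalue (i : nat) : R :=
  item1 (eigenvalues (linfun (interior_laplacian G (B := B)))) i.

Definition degB_sorted (k : nat) : R :=
  item1 (sort <=%R [seq degB G x | x : interior B]) k.

End Spectra.

(* Main.v *)
(** The Dirichlet Laplacian is the interior Laplacian plus multiplication by
    Deg_B, and all three operators are self-adjoint for the m-weighted inner
    product, so both inequalities are instances of Weyl's inequalities for a
    sum h = f + g.  For each of f, g, h take the span of the eigenvectors whose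
    eigenvalues lie on one side of the relevant one: there the Rayleigh quotient
    is bounded by that eigenvalue, with equality only at eigenvectors.  In both
    cases the three dimensions add up to 2n + 1, so the three subspaces share a
    nonzero u; comparing the three quadratic forms at u gives the inequality,
    and equality forces u to be a common eigenvector.  The spectral theorem is
    obtained from the algebraic closedness of R[i]. *)

Require Import Defs.
From HB Require Import structures.
From mathcomp Require Import all_boot all_order all_algebra.
From mathcomp Require Import polyrcf complex.
From mathcomp Require Import reals.
From mathcomp Require Import zify ring lra.

Set Implicit Arguments.
Unset Strict Implicit.
Unset Printing Implicit Defensive.

Import Order.TTheory GRing.Theory Num.Theory.
Import passmx.

Local Open Scope ring_scope.

(** * Eigenvectors, invariant subspaces and orthogonal complements *)

Lemma mem_leigenspace (F : fieldType) (U : vectType F) (f : 'End(U)) a u :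
  (u \in leigenspace f a) = (f u == a *: u).
Proof.
by rewrite memv_ker add_lfunE opp_lfunE scale_lfunE id_lfunE subr_eq0.
Qed.

Lemma leigenspaceN (F : fieldType) (U : vectType F) (f : 'End(U)) a :
  leigenspace (- f) (- a) = leigenspace f a.
Proof.
by apply/vspaceP => u; rewrite !mem_leigenspace opp_lfunE scaleNr eqr_opp.
Qed.

(* With z = a + i b, the two equations are the real and imaginary parts of
   f (u + i v) = z (u + i v). *)
Lemma complex_eigenpair (R : rcfType) (U : vectType R) (f : 'End(U)) :
  (0 < \dim {:U})%N -> exists a b u v,
    [/\ (u != 0) || (v != 0), f u = a *: u - b *: v & f v = b *: u + a *: v].
Proof.
move=> U_gt0; have e_basis := vbasisP {:U}.
set M := mxof (vbasis {:U}) (vbasis {:U}) f.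
(* [R[i]] is algebraically closed, so the complexified matrix has an eigenvalue; eigenvectors are
   rows, multiplied by the matrix on the right. *)
have [[a b]] := eigenvalue_closed (map_mx (real_complex R) M) U_gt0.
case/eigenvalueP=> w wM w_neq0.
pose wr := map_mx (@complex.Re R) w; pose wi := map_mx (@complex.Im R) w.
have ReD : {morph @complex.Re R : x y / x + y} by case=> ? ? [].
have ImD : {morph @complex.Im R : x y / x + y} by case=> ? ? [].
have wrM : wr *m M = a *: wr - b *: wi.
  apply/rowP => j; have /rowP/(_ j)/(congr1 (@complex.Re R)) := wM.
  rewrite !mxE (big_morph _ ReD (erefl _)) => eRe; transitivity
    (complex.Re ((a +i* b)%C * w 0 j)).
    rewrite -eRe; apply: eq_bigr => k _.
    by rewrite !mxE; case: (w 0 k) => p q /=; rewrite mulr0 subr0.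
  by case: (w 0 j).
have wiM : wi *m M = b *: wr + a *: wi.
  apply/rowP => j; have /rowP/(_ j)/(congr1 (@complex.Im R)) := wM.
  rewrite !mxE (big_morph _ ImD (erefl _)) => eIm; transitivity
    (complex.Im ((a +i* b)%C * w 0 j)).
    rewrite -eIm; apply: eq_bigr => k _.
    by rewrite !mxE; case: (w 0 k) => p q /=; rewrite mulr0 add0r.
  by case: (w 0 j) => p q /=; rewrite addrC.
exists a, b, (vecof (vbasis {:U}) wr), (vecof (vbasis {:U}) wi); split.
- rewrite !vecof_eq0 // -negb_and; apply: contra w_neq0 => /andP[/eqP r0 /eqP i0].
  apply/eqP/rowP => j; move/rowP/(_ j): r0; move/rowP/(_ j): i0.
  by rewrite !mxE; case: (w 0 j) => p q /= -> ->.
- by rewrite (hom_vecof _ e_basis) // -/M wrM linearB !linearZ.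
- by rewrite (hom_vecof _ e_basis) // -/M wiM linearD !linearZ.
Qed.

(** Invariance of [W] lets [f] restrict to the space [subvs_of W], where [complex_eigenpair]
    applies. *)
Lemma complex_eigenpair_in (R : rcfType) (U : vectType R) (f : 'End(U))
    (W : {vspace U}) :
  W != 0%VS -> {in W, forall u, f u \in W} -> exists a b u v,
    [/\ u \in W, v \in W, (u != 0) || (v != 0),
        f u = a *: u - b *: v & f v = b *: u + a *: v].
Proof.
move=> W_neq0 fW; pose g : 'End(subvs_of W) := linfun (vsproj W \o f \o vsval).
have gE x : vsval (g x) = f (vsval x).
  by rewrite lfunE /= vsprojK // fW // subvsP.
have [|a [b [u [v [uv0 gu gv]]]]] := complex_eigenpair g.
  by rewrite dimvf /dim /= lt0n dimv_eq0.
exists a, b, (vsval u), (vsval v); rewrite !subvsP; split=> //.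
- by rewrite -gE gu linearB !linearZ.
- by rewrite -gE gv linearD !linearZ.
Qed.

(** Pairing with a basis of [W] is a linear map to a space of dimension [\dim W]; by rank-nullity
    its kernel is nonzero when [W] is proper. *)
Lemma orthov_neq0 (F : fieldType) eps (theta : {rmorphism F -> F}) (U : vectType F)
    (form : {hermitian U for eps & theta}) (W : {vspace U}) :
  W != fullv -> exists2 u, u != 0 & u \in orthov form W.
Proof.
move=> W_neq; pose phi (u : U) := \row_(i < \dim W) form u (vbasis W)`_i.
have phiP : linear phi.
  by move=> c u v; apply/rowP => i; rewrite !mxE linearPl.
pose L := GRing.isLinear.Build F U 'rV_(\dim W) _ phi phiP.
pose Phi : {linear U -> 'rV_(\dim W)} := HB.pack phi L.
have ker_neq0 : lker (linfun Phi) != 0%VS.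
  apply: contra W_neq => /eqP ker0.
  rewrite -[_ == _](geq_leqif (dimv_leqif_eq (subvf W))).
  have := limg_ker_dim (linfun Phi) fullv.
  rewrite ker0 capv0 dimv0 add0n => <-.
  by rewrite (leq_trans (dimvS (subvf _))) // dimvf /dim /= mul1n.
exists (vpick (lker (linfun Phi))); first by rewrite vpick0.
have := memv_pick (lker (linfun Phi)); move: (vpick _) => u.
rewrite memv_ker lfunE => /eqP/rowP u0; apply/mem_orthovP => v vW.
rewrite (coord_vbasis vW) linear_sumr big1 // => i _.
by have := u0 i; rewrite linearZr_LR !mxE /= => ->; rewrite mulr0.
Qed.

(** After exchanging the sums, each entry of [s] meets exactly one element of [undup s]. *)
Lemma count_undup_sum (T : eqType) (P : pred T) (s : seq T) :
  (\sum_(a <- undup s | P a) count_mem a s = count P s)%N.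
Proof.
under eq_bigr do rewrite -sum1_count big_mkcond.
rewrite exchange_big -sum1_count [RHS]big_mkcond /= !big_seq.
apply: eq_bigr => x xs; rewrite -big_mkcondr /=.
rewrite sum1_count (eq_count (a2 := fun a => P x && pred1 x a)) => [|a /=].
  by case: (P x); rewrite ?count_pred0 // count_uniq_mem ?undup_uniq // mem_undup xs.
by rewrite eq_sym; case: eqVneq => [->|]; rewrite ?andbF.
Qed.

(** * The spectral theorem for self-adjoint operators *)

Section SelfAdjoint.
Context {R : realType} {U : vectType R}.
Variable (form : {dot U for idfun}).
Implicit Types (f g h : 'End(U)) (W : {vspace U}).

Local Notation "''[' u , v ]" := (form u%R v%R) : ring_scope.
Local Notation "''[' u ]" := '[u, u]%R : ring_scope.

Definition self_adjoint f := forall u v, '[f u, v] = '[u, f v].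

Lemma dotC u v : '[u, v] = '[v, u].
Proof. by rewrite hermC expr0 mul1r. Qed.

Lemma dotDl u v w : '[u + v, w] = '[u, w] + '[v, w].
Proof. exact: linearDl. Qed.

Lemma dotDr u v w : '[u, v + w] = '[u, v] + '[u, w].
Proof. exact: linearDr. Qed.

Lemma dotZl c u v : '[c *: u, v] = c * '[u, v].
Proof. exact: linearZl_LR. Qed.

Lemma dotZr c u v : '[u, c *: v] = c * '[u, v].
Proof. exact: linearZr_LR. Qed.

Lemma dotNl u v : '[- u, v] = - '[u, v].
Proof. exact: linearNl. Qed.

Lemma dotNr u v : '[u, - v] = - '[u, v].
Proof. exact: linearNr. Qed.

Lemma dot0l u : '[0, u] = 0.
Proof. exact: linear0l. Qed.

Lemma dot_suml (I : finType) (P : pred I) (u_ : I -> U) v :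
  '[\sum_(i | P i) u_ i, v] = \sum_(i | P i) '[u_ i, v].
Proof. exact: linear_sumlz. Qed.

Lemma dot_sumr (I : finType) (P : pred I) v (u_ : I -> U) :
  '[v, \sum_(i | P i) u_ i] = \sum_(i | P i) '[v, u_ i].
Proof. exact: linear_sumr. Qed.

Lemma dot_ge0 u : 0 <= '[u].
Proof.
by have [->|/neq0_dnorm_gt0/ltW//] := eqVneq u 0; rewrite dot0l.
Qed.

Lemma dot_eq0 u : ('[u] == 0) = (u == 0).
Proof.
have [->|/neq0_dnorm_gt0/lt0r_neq0/negbTE//] := eqVneq u 0.
by rewrite dot0l eqxx.
Qed.


Lemma self_adjointN f : self_adjoint f -> self_adjoint (- f).
Proof. by move=> fS u v; rewrite !opp_lfunE dotNl dotNr fS. Qed.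

Lemma self_adjointD f g :
  self_adjoint f -> self_adjoint g -> self_adjoint (f + g).
Proof. by move=> fS gS u v; rewrite !add_lfunE dotDl dotDr fS gS. Qed.

Lemma leigenspace_ortho f a b u v : self_adjoint f -> a != b ->
  u \in leigenspace f a -> v \in leigenspace f b -> '[u, v] = 0.
Proof.
move=> fS ab; rewrite !mem_leigenspace => /eqP fu /eqP fv.
have /eqP := fS u v; rewrite fu fv dotZl dotZr -subr_eq0 -mulrBl.
by rewrite mulf_eq0 subr_eq0 (negbTE ab) => /eqP.
Qed.

(** The weights sit in one slot only: [c = 1] serves for the directness of the sum of eigenspaces,
    differences of eigenvalues for the Rayleigh bound. *)
Lemma dot_sum_ortho (I : finType) (P : pred I) (c : I -> R) (u_ : I -> U) :
  (forall i j, P i -> P j -> i != j -> '[u_ i, u_ j] = 0) ->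
  '[\sum_(i | P i) c i *: u_ i, \sum_(i | P i) u_ i]
    = \sum_(i | P i) c i * '[u_ i].
Proof.
move=> u_ortho; rewrite dot_suml; apply: eq_bigr => i Pi.
rewrite dotZl dot_sumr (bigD1 i) //= big1 ?addr0 // => j /andP[Pj ji].
by rewrite u_ortho // eq_sym.
Qed.

(** If orthogonal vectors add up to zero, so do their square norms, hence each vector is zero. *)
Lemma directv_leigenspace f (I : finType) (P : pred I) (a : I -> R) :
  self_adjoint f -> injective a ->
  directv (\sum_(i | P i) leigenspace f (a i)).
Proof.
move=> fS a_inj; apply/directv_sum_independent => u_ Uu u0 i Pi.
have u_ortho j k : P j -> P k -> j != k -> '[u_ j, u_ k] = 0.
  move=> Pj Pk jk; apply: (leigenspace_ortho fS) (Uu _ Pj) (Uu _ Pk).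
  by rewrite inj_eq.
have := dot_sum_ortho (fun=> 1) u_ortho.
rewrite u0 dotC dot0l => /esym sum0; apply/eqP; rewrite -dot_eq0; apply/eqP.
rewrite -[LHS]mul1r; move: i Pi; apply: (psumr_eq0P _ sum0) => j _.
by rewrite mul1r dot_ge0.
Qed.

(** On a complex eigenpair, ['[f u, v] = '[u, f v]] gives [b * ('[u] + '[v]) = 0], so the eigenvalue
    is real. *)
Lemma eigenvector_in f W : self_adjoint f -> W != 0%VS ->
  {in W, forall u, f u \in W} ->
  exists a, exists2 u, u != 0 & u \in W /\ f u = a *: u.
Proof.
move=> fS W0 fW.
have [a [b [u [v [uW vW uv0 fu fv]]]]] := complex_eigenpair_in W0 fW.
have b0 : b = 0.
  have /eqP := fS u v; rewrite fu fv dotDl dotNl dotDr !dotZl !dotZr.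
  rewrite addrC (inj_eq (addIr _)) eq_sym -subr_eq0 opprK -mulrDr mulf_eq0.
  case/orP=> /eqP // /eqP; rewrite paddr_eq0 ?dot_ge0 // !dot_eq0.
  by move/negPn; rewrite negb_and uv0.
move: fu fv; rewrite b0 !scale0r subr0 add0r => fu fv; exists a.
by case/orP: uv0 => [u0|v0]; [exists u|exists v].
Qed.

Lemma uniq_roots_lchar f : uniq (rootsR (lchar_poly f)).
Proof. exact: (sorted_uniq lt_trans ltxx (sorted_roots _ _ _)). Qed.

(** The orthogonal complement of the sum is [f]-invariant. Were it nonzero, it would contain an
    eigenvector; this would lie in the sum as well and be orthogonal to itself. *)
Lemma sum_leigenspace f : self_adjoint f ->
  (\sum_(a <- rootsR (lchar_poly f)) leigenspace f a)%VS = fullv.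
Proof.
move=> fS; set S := (X in X = _); apply/eqP/negPn/negP=> /(orthov_neq0 form).
case=> w w0 wS.
have S_inv v : v \in S -> f v \in S.
  rewrite /S; elim/big_ind: _ v => [v|V1 V2 IH1 IH2 v|a _ v].
  - by rewrite memv0 => /eqP->; rewrite linear0 mem0v.
  - by case/memv_addP=> v1 /IH1 ? [v2 /IH2 ? ->]; rewrite linearD memv_add.
  - by move=> va; move: (va); rewrite mem_leigenspace => /eqP->; rewrite memvZ.
have [||a [u u0 [uS fu]]] := @eigenvector_in f (orthov form S) fS.
- by apply: contra w0 => /eqP S0; rewrite S0 memv0 in wS.
- move=> v /mem_orthovP vS; apply/mem_orthovP => x xS.
  exact: etrans (fS v x) (vS _ (S_inv _ xS)).
suff: u \in S by move/mem_orthovP: uS => uS /uS /eqP; rewrite dot_eq0 (negbTE u0).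
have ua : u \in leigenspace f a by rewrite mem_leigenspace fu.
have a_root : a \in rootsR (lchar_poly f).
  have p0 : lchar_poly f != 0 by rewrite monic_neq0 // char_poly_monic.
  have := roots_on_rootsR p0 a; rewrite in_itv /= => <-; rewrite root_lchar_poly.
  by apply: contra u0 => /eqP ea; rewrite ea memv0 in ua.
rewrite /S (bigD1_seq a) ?uniq_roots_lchar //=.
by rewrite -[u]addr0 memv_add ?mem0v.
Qed.

Lemma dim_sum_leigenspace f (r : seq R) (P : pred R) : self_adjoint f -> uniq r ->
  \dim (\sum_(a <- r | P a) leigenspace f a)
    = (\sum_(a <- r | P a) \dim (leigenspace f a))%N.
Proof.
move=> fS r_uniq; rewrite big_tnth [RHS]big_tnth.
have r_inj : injective (tnth (in_tuple r)) by apply/tuple_uniqP.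
by have /directvP /= := directv_leigenspace
  (fun i => P (tnth (in_tuple r) i)) fS r_inj.
Qed.

Lemma size_eigenvalues f : self_adjoint f -> size (eigenvalues f) = \dim {:U}.
Proof.
move=> fS; rewrite -(sum_leigenspace fS) dim_sum_leigenspace ?uniq_roots_lchar //.
rewrite /eigenvalues size_flatten /shape -map_comp sumnE big_map.
by apply: eq_bigr => a _; rewrite /= size_nseq.
Qed.

(** * Rayleigh bounds on sums of eigenspaces *)

(** The quotient is cleared of its denominator, so [u = 0] is no exception. Lower bounds are
    expressed as upper bounds for [- f]. *)
Definition rayleigh_le f c W := {in W, forall u,
  '[f u, u] <= c * '[u] /\ ('[f u, u] = c * '[u] -> f u = c *: u)}.

(** Along the orthogonal decomposition of [u], the gap [c * '[u] - '[f u, u]] is a sum of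
    nonnegative terms [(c - a i) * '[u_ i]]. If it vanishes, so does every [(c - a i) *: u_ i], and
    these add up to [c *: u - f u]. *)
Lemma rayleigh_le_sum f (r : seq R) (P : pred R) c :
  self_adjoint f -> uniq r -> {in P, forall a, a <= c} ->
  rayleigh_le f c (\sum_(a <- r | P a) leigenspace f a).
Proof.
move=> fS r_uniq P_le u; rewrite big_tnth => /memv_sumP[u_ Uu uE].
set a := fun i => tnth (in_tuple r) i in Uu uE.
pose Q i := P (a i); have a_inj : injective a by apply/tuple_uniqP.
have u_ortho i j : Q i -> Q j -> i != j -> '[u_ i, u_ j] = 0.
  move=> Qi Qj ij; apply: (leigenspace_ortho fS) (Uu _ Qi) (Uu _ Qj).
  by rewrite inj_eq.
have gapE : c *: u - f u = \sum_(i | Q i) (c - a i) *: u_ i.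
  rewrite uE scaler_sumr linear_sum -sumrB; apply: eq_bigr => i Qi.
  rewrite scalerBl; congr (_ - _); apply/eqP.
  by rewrite -mem_leigenspace Uu.
have gap_dot : c * '[u] - '[f u, u] = \sum_(i | Q i) (c - a i) * '[u_ i].
  by rewrite -(dot_sum_ortho _ u_ortho) -gapE -uE dotDl dotNl dotZl.
have gap_ge0 i : Q i -> 0 <= (c - a i) * '[u_ i].
  by move=> Qi; rewrite mulr_ge0 ?dot_ge0 // subr_ge0 P_le.
split=> [|fu_eq]; first by rewrite -subr_ge0 gap_dot sumr_ge0.
apply/eqP; rewrite eq_sym -subr_eq0 gapE big1 // => i Qi.
move/esym: gap_dot; rewrite fu_eq subrr => gap0.
have /eqP := psumr_eq0P gap_ge0 gap0 Qi.
by rewrite mulf_eq0 dot_eq0 => /orP[] /eqP->; rewrite ?scale0r ?scaler0.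
Qed.

Lemma rayleigh_le_sumN f (r : seq R) (P : pred R) c :
  self_adjoint f -> uniq r -> {in P, forall a, c <= a} ->
  rayleigh_le (- f) (- c) (\sum_(a <- r | P a) leigenspace f a).
Proof.
move=> fS r_uniq P_ge.
have -> : (\sum_(a <- r | P a) leigenspace f a)%VS =
  (\sum_(b <- map -%R r | P (- b)) leigenspace (- f) b)%VS.
  by rewrite big_map; under [RHS]eq_big do [rewrite opprK|rewrite leigenspaceN].
apply: rayleigh_le_sum; first exact: self_adjointN.
  by rewrite map_inj_uniq //; apply: oppr_inj.
by move=> b /P_ge; rewrite lerNr.
Qed.

(* The symmetric form f + g + h = 0 serves both Weyl inequalities, up to sign. *)
Lemma rayleigh_le_weyl f g h a b c W1 W2 W3 : f + g + h = 0 ->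
  rayleigh_le f a W1 -> rayleigh_le g b W2 -> rayleigh_le h c W3 ->
  (2 * \dim {:U} < \dim W1 + \dim W2 + \dim W3)%N ->
  0 <= a + b + c /\ (a + b + c = 0 -> exists u,
    [/\ u != 0, f u = a *: u, g u = b *: u & h u = c *: u]).
Proof.
move=> fgh0 fW gW hW dimW.
have cap_neq0 : (W1 :&: W2 :&: W3)%VS != 0%VS.
  rewrite -dimv_eq0 -lt0n.
  (* Each of the two intersections costs at most [\dim {:U}] in the sum of the dimensions. *)
  have := dimv_sum_cap W1 W2; have := dimv_sum_cap (W1 :&: W2) W3.
  have := dimvS (subvf (W1 + W2)); have := dimvS (subvf (W1 :&: W2 + W3)).
  lia.
set u := vpick (W1 :&: W2 :&: W3); have u0 : u != 0 by rewrite vpick0.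
have := memv_pick (W1 :&: W2 :&: W3); rewrite -/u !memv_cap -andbA.
case/and3P=> /fW[fu fu_eq] /gW[gu gu_eq] /hW[hu hu_eq].
have uu_gt0 : 0 < '[u] by apply: neq0_dnorm_gt0.
have dot0 : '[f u, u] + '[g u, u] + '[h u, u] = 0.
  by rewrite -!dotDl -!add_lfunE fgh0 zero_lfunE dot0l.
split=> [|abc0].
  rewrite -(pmulr_lge0 _ uu_gt0); lra.
(* Both the three bounds and the three forms now sum to zero, so each bound is attained. *)
have : (a + b + c) * '[u] = 0 by rewrite abc0 mul0r.
move=> abcu; exists u; split=> //; [apply: fu_eq|apply: gu_eq|apply: hu_eq]; lra.
Qed.

(* The inequality is enough: the size condition then forces equality. *)
Definition is_spectrum f (s : seq R) := [/\ sorted <=%R s, size s = \dim {:U}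
  & forall a, (count_mem a s <= \dim (leigenspace f a))%N].

Lemma spectrum_eigenvalues f : self_adjoint f -> is_spectrum f (eigenvalues f).
Proof.
move=> fS; split; [exact: eigenvalues_sorted|exact: size_eigenvalues|].
by move=> a; rewrite count_eigenvalues.
Qed.

(** Eigenspaces for distinct values are independent, so multiplicities add up. *)
Lemma count_le_dim_leigenspace f s (P : pred R) :
  self_adjoint f -> is_spectrum f s ->
  (count P s <= \dim (\sum_(a <- undup s | P a) leigenspace f a))%N.
Proof.
move=> fS [_ _ s_dim]; rewrite dim_sum_leigenspace ?undup_uniq //.
by rewrite -count_undup_sum; apply: leq_sum => a _; apply: s_dim.
Qed.

(** Indices are 0-based: the first [k.+1] entries are at most the entry at [k], whence the strict
    bound on the dimension. *)
Lemma spectrum_low f s k : self_adjoint f -> is_spectrum f s ->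
  (k < size s)%N -> exists2 W, (k < \dim W)%N & rayleigh_le f s`_k W.
Proof.
move=> fS fs ks; pose P : pred R := <=%R^~ s`_k.
exists (\sum_(a <- undup s | P a) leigenspace f a)%VS; last first.
  exact: rayleigh_le_sum fS (undup_uniq _) _.
apply: leq_trans (count_le_dim_leigenspace P fS fs); have [s_sorted _ _] := fs.
rewrite -(cat_take_drop k.+1 s) count_cat.
apply: leq_trans (leq_addr _ _); rewrite -[X in (X <= _)%N](size_takel ks).
have /eqP-> // : count P (take k.+1 s) == size (take k.+1 s).
rewrite -all_count; apply/(all_nthP 0) => i; rewrite size_takel // => ik.
rewrite nth_take // /P /=.
by apply: (sorted_leq_nth le_trans le_refl) => //; exact: leq_ltn_trans ks.
Qed.

(** The [size s - k] entries from position [k] on are at least the entry at [k]. For [k] past the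
    end, truncated subtraction makes the dimension bound trivial. *)
Lemma spectrum_high f s k : self_adjoint f -> is_spectrum f s ->
  exists2 W, (size s - k <= \dim W)%N & rayleigh_le (- f) (- s`_k) W.
Proof.
move=> fS fs; pose P : pred R := <=%R s`_k.
exists (\sum_(a <- undup s | P a) leigenspace f a)%VS; last first.
  exact: rayleigh_le_sumN fS (undup_uniq _) _.
apply: leq_trans (count_le_dim_leigenspace P fS fs); have [s_sorted _ _] := fs.
suff /eqP countP : count P (drop k s) == size (drop k s).
  rewrite -size_drop -countP -[X in (_ <= count _ X)%N](cat_take_drop k s).
  by rewrite count_cat leq_addl.
rewrite -all_count; apply/(all_nthP 0) => i; rewrite size_drop => ik.
have lt_ki : (k + i < size s)%N by rewrite -ltn_subRL.
rewrite nth_drop /P /= (sorted_leq_nth le_trans le_refl) ?leq_addr ?inE //.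
exact: leq_ltn_trans (leq_addr i k) lt_ki.
Qed.

(** * Weyl's inequalities with their equality cases *)

Lemma common_eigenvector_eq f g h a b c :
  h = f + g -> (exists u, [/\ u != 0, h u = c *: u, f u = a *: u & g u = b *: u]) ->
  c = a + b.
Proof.
move=> -> [u [u0 hu fu gu]]; apply/eqP; rewrite -subr_eq0.
have /eqP := hu; rewrite add_lfunE fu gu -scalerDl eq_sym -subr_eq0 -scalerBl.
by rewrite scaler_eq0 (negbTE u0) orbF.
Qed.

(** With [n = \dim {:U}], low subspaces for [f] and [g] and a high one for [h] have dimensions at
    least [k + 1], [l + 1] and [n - i], in total [2 * n + 1] by the index relation. The operators
    with zero sum are [f], [g] and [- h]. *)
Lemma weyl_upper f g h sf sg sh k l i :
  self_adjoint f -> self_adjoint g -> h = f + g ->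
  is_spectrum f sf -> is_spectrum g sg -> is_spectrum h sh ->
  (i < \dim {:U})%N -> (k < \dim {:U})%N -> (l < \dim {:U})%N ->
  (k + l).+1 = (i + \dim {:U})%N ->
  sh`_i <= sf`_k + sg`_l /\ (sh`_i = sf`_k + sg`_l <-> exists u,
    [/\ u != 0, h u = sh`_i *: u, f u = sf`_k *: u & g u = sg`_l *: u]).
Proof.
move=> fS gS hE f_s g_s h_s lt_i lt_k lt_l kl_i.
have hS : self_adjoint h by rewrite hE; apply: self_adjointD.
have [[_ szf _] [_ szg _] [_ szh _]] := And3 f_s g_s h_s.
have [|W1 dimW1 fW] := spectrum_low (k := k) fS f_s; first by rewrite szf.
have [|W2 dimW2 gW] := spectrum_low (k := l) gS g_s; first by rewrite szg.
have [W3 dimW3 hW] := spectrum_high i hS h_s.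
have [||le0 ex_u] := rayleigh_le_weyl _ fW gW hW; first by rewrite hE subrr.
  by rewrite szh in dimW3; lia.
split; first by lra.
split=> [eq_i|]; last exact: common_eigenvector_eq.
have [|u [u0 fu gu hu]] := ex_u; first by lra.
exists u; split=> //.
by move: hu; rewrite opp_lfunE scaleNr => /oppr_inj.
Qed.

(** The roles are reversed: high subspaces for [f] and [g] and a low one for [h], with bounds
    [n - k], [n - l] and [i + 1], again [2 * n + 1] in total. The operators with zero sum are [- f],
    [- g] and [h]. *)
Lemma weyl_lower f g h sf sg sh k l i :
  self_adjoint f -> self_adjoint g -> h = f + g ->
  is_spectrum f sf -> is_spectrum g sg -> is_spectrum h sh ->
  (i < \dim {:U})%N -> (k + l)%N = i ->
  sf`_k + sg`_l <= sh`_i /\ (sh`_i = sf`_k + sg`_l <-> exists u,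
    [/\ u != 0, h u = sh`_i *: u, f u = sf`_k *: u & g u = sg`_l *: u]).
Proof.
move=> fS gS hE f_s g_s h_s lt_i kl_i.
have hS : self_adjoint h by rewrite hE; apply: self_adjointD.
have [[_ szf _] [_ szg _] [_ szh _]] := And3 f_s g_s h_s.
have [W1 dimW1 fW] := spectrum_high k fS f_s.
have [W2 dimW2 gW] := spectrum_high l gS g_s.
have [|W3 dimW3 hW] := spectrum_low (k := i) hS h_s; first by rewrite szh.
have [||le0 ex_u] := rayleigh_le_weyl _ fW gW hW.
- by rewrite hE -opprD addNr.
- by rewrite szf in dimW1; rewrite szg in dimW2; lia.
split; first by lra.
split=> [eq_i|]; last exact: common_eigenvector_eq.
have [|u [u0 fu gu hu]] := ex_u; first by lra.
exists u; split=> //; [move: fu|move: gu];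
  by rewrite opp_lfunE scaleNr => /oppr_inj.
Qed.

End SelfAdjoint.

(** * The three operators on functions on the interior *)

Lemma dim_rfun (R : realType) (S : finType) : \dim {:rfun R S} = #|S|.
Proof. by rewrite dimvf /dim /= muln1. Qed.

Lemma leq_card_dimv (R : realType) (S : finType) (P : pred S)
    (W : {vspace rfun R S}) :
  (forall u : rfun R S, (forall x, ~~ P x -> u x = 0) -> u \in W) ->
  (#|P| <= \dim W)%N.
Proof.
(* W contains the kernel of the restriction map to the complement of P. *)
move=> PW; pose T : finType := {x : S | ~~ P x}.
pose rho (u : rfun R S) : rfun R T := [ffun x => u (val x)].
have rho_lin : linear rho by move=> c u v; apply/ffunP => x; rewrite !ffunE.
pose Rho : {linear rfun R S -> rfun R T} :=
  HB.pack rho (GRing.isLinear.Build R (rfun R S) (rfun R T) _ rho rho_lin).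
have kerW : (lker (linfun Rho) <= W)%VS.
  apply/subvP => u; rewrite memv_ker lfunE => /eqP/ffunP u0; apply: PW => x Px.
  by have := u0 (Sub x Px); rewrite !ffunE SubK.
apply: leq_trans (dimvS kerW).
have := limg_ker_dim (linfun Rho) fullv; rewrite capfv dim_rfun.
have := dimvS (subvf (linfun Rho @: fullv)); rewrite dim_rfun card_sig.
have := cardC P; rewrite -[#|[pred x | ~~ P x]|]/(#|predC P|); lia.
Qed.

Section WeightedGraph.
Context {R : realType} {V : finType}.
Variables (G : weighted_graph R V) (B : {set V}).
Local Notation Omega := (interior B).
Local Notation m := (vmeas G).
Local Notation w := (weight G).

Definition rdot (u v : rfun R Omega) : R :=
  \sum_(x : Omega) m (val x) * (u x : R) * (v x : R).

Fact rdotC u v : rdot u v = rdot v u.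
Proof. by apply: eq_bigr => x _; rewrite mulrAC. Qed.

Fact rdot_linearl v : scalar (rdot^~ v).
Proof.
move=> a u1 u2; rewrite mulr_sumr -big_split; apply: eq_bigr => x _ /=.
rewrite !ffunE /= /GRing.scale /=; ring.
Qed.

Fact rdot_linearr u : linear_for (idfun \; *%R) (rdot u).
Proof. by move=> a v1 v2; rewrite rdotC rdot_linearl !(rdotC _ u). Qed.

HB.instance Definition _ := bilinear_isBilinear.Build R
  (rfun R Omega) (rfun R Omega) R *%R (idfun \; *%R) rdot
  (rdot_linearl, rdot_linearr).

Fact rdot_hermitian u v : rdot u v = (-1) ^+ false * idfun (rdot v u).
Proof. by rewrite expr0 mul1r rdotC. Qed.

HB.instance Definition _ := isHermitianSesquilinear.Build R
  (rfun R Omega) false idfun rdot rdot_hermitian.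

Fact rdot_gt0 u : u != 0 -> 0 < rdot u u.
Proof.
move=> u_neq0; have [x ux] : exists x, u x != 0.
  apply/existsP; apply: contraNT u_neq0; rewrite negb_exists => /forallP u0.
  by apply/eqP/ffunP => x; rewrite ffunE; apply/eqP/negPn.
rewrite /rdot (bigD1 x) //= ltr_wpDr //.
  by apply: sumr_ge0 => y _; rewrite -mulrA -expr2 mulr_ge0 ?sqr_ge0 ?ltW ?vmeas_gt0.
by rewrite -mulrA -expr2 mulr_gt0 ?vmeas_gt0 // lt0r sqrf_eq0 ux sqr_ge0.
Qed.

HB.instance Definition _ :=
  isDotProduct.Build R (rfun R Omega) rdot rdot_gt0.

Local Notation DL := (linfun (dirichlet_laplacian G (B := B))).
Local Notation IL := (linfun (interior_laplacian G (B := B))).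

Fact degB_mul_is_linear : linear (@degB_mul R V G B).
Proof.
move=> a u v; apply/ffunP => x; rewrite !ffunE /= /GRing.scale /=; ring.
Qed.

HB.instance Definition _ := GRing.isLinear.Build R (rfun R Omega) (rfun R Omega)
  _ (@degB_mul R V G B) degB_mul_is_linear.

Local Notation DM := (linfun (degB_mul G (B := B))).

(** The measure cancels. Both double sums are unchanged when [f] and [g] are swapped: the first
    termwise, the second by exchanging [x] and [y] and the symmetry of [w]. *)
Lemma weighted_green (f g : Omega -> R) :
  \sum_(x : Omega) m (val x) * ((m (val x))^-1 *
      \sum_(y : Omega) (f x - f y) * w (val x) (val y)) * g x =
  \sum_(x : Omega) \sum_(y : Omega) f x * g x * w (val x) (val y) -
  \sum_(x : Omega) \sum_(y : Omega) f y * g x * w (val x) (val y).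
Proof.
rewrite -sumrB; apply: eq_bigr => x _; rewrite mulVKf ?gt_eqF ?vmeas_gt0 //.
by rewrite -sumrB mulr_suml; apply: eq_bigr => y _; ring.
Qed.

Lemma interior_laplacian_self_adjoint : self_adjoint rdot IL.
Proof.
move=> u v; rewrite !lfunE /= [RHS]rdotC /rdot.
under eq_bigr do rewrite ffunE; under [RHS]eq_bigr do rewrite ffunE.
rewrite !weighted_green; congr (_ - _).
  by apply: eq_bigr => x _; apply: eq_bigr => y _; rewrite (mulrC (u x)).
rewrite exchange_big; apply: eq_bigr => x _; apply: eq_bigr => y _.
by rewrite weight_sym (mulrC (u x)).
Qed.

Lemma degB_mul_self_adjoint : self_adjoint rdot DM.
Proof.
by move=> u v; rewrite !lfunE; apply: eq_bigr => x _; rewrite !ffunE; ring.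
Qed.

(** The extension by zero vanishes at [y] in [B], so such a [y] contributes [u x * w x y]; these
    terms make up the [degB] part, and the interior ones the interior Laplacian. *)
Lemma dirichlet_laplacianE : DL = IL + DM.
Proof.
apply/lfunP => u; apply/ffunP => x; rewrite add_lfunE !lfunE /= !ffunE /=.
rewrite -mulrA -mulrDr; congr (_ * _).
rewrite valK (bigID (mem B)) /= addrC; congr (_ + _); last first.
  rewrite mulr_suml; apply: eq_bigr => y yB; rewrite ffunE insubN ?negbK //.
  by rewrite subr0 mulrC.
rewrite (reindex_omap (val : Omega -> V) insub) => [|y yB]; last by rewrite insubT.
apply: eq_big => [y|y _]; first by rewrite valK eqxx (valP y).
by rewrite ffunE valK.
Qed.

(** Functions supported on the level set where [degB] equals [a] lie in the eigenspace for [a], and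
    the multiplicity of [a] in the list is the size of that set. *)
Lemma degB_mul_spectrum :
  is_spectrum DM (sort <=%R [seq degB G x | x : Omega]).
Proof.
split; first exact: sort_le_sorted.
  by rewrite size_sort size_map -cardT dim_rfun.
move=> a; have -> : count_mem a (sort <=%R [seq degB G x | x : Omega]) =
    #|[pred x : Omega | degB G x == a]|.
  by rewrite count_sort count_map cardE [in RHS]/enum_mem size_filter -enumT.
apply: leq_card_dimv => u u0; rewrite mem_leigenspace lfunE; apply/eqP/ffunP => x.
rewrite !ffunE /=; have [->//|/u0->] := eqVneq (degB G x) a.
by rewrite mulr0 scaler0.
Qed.

Lemma spectral_data : [/\ self_adjoint rdot IL, self_adjoint rdot DM, DL = IL + DM,
  is_spectrum IL (eigenvalues IL) & is_spectrum DL (eigenvalues DL)].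
Proof.
have ILS := interior_laplacian_self_adjoint; have DMS := degB_mul_self_adjoint.
split=> //; [exact: dirichlet_laplacianE|exact: spectrum_eigenvalues ILS|].
apply: (spectrum_eigenvalues (form := rdot)); rewrite dirichlet_laplacianE.
exact: self_adjointD.
Qed.

Lemma common_eigenvector_linfun a b c :
  (exists u, [/\ u != 0, DL u = c *: u, IL u = a *: u & DM u = b *: u]) <->
  (exists u : rfun R Omega, [/\ u != 0, dirichlet_laplacian G u = c *: u,
     interior_laplacian G u = a *: u & degB_mul G u = b *: u]).
Proof. by split=> -[u]; rewrite ?lfunE => ?; exists u; rewrite ?lfunE. Qed.

End WeightedGraph.

Theorem theorem1p3 (R : realType) (V : finType) (G : weighted_graph R V)
    (B : {set V}) (hB : B != set0) :
  (forall i j : nat, (1 <= i <= #|interior B|)%N -> (j <= #|interior B| - i)%N ->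
     dirichlet_eigenvalue G B i
       <= interior_eigenvalue G B (i + j) + degB_sorted G B (#|interior B| - j)
     /\ (dirichlet_eigenvalue G B i
           = interior_eigenvalue G B (i + j) + degB_sorted G B (#|interior B| - j)
         <-> exists u : rfun R (interior B),
           [/\ u != 0,
               dirichlet_laplacian G u = dirichlet_eigenvalue G B i *: u,
               interior_laplacian G u = interior_eigenvalue G B (i + j) *: u
             & degB_mul G u = degB_sorted G B (#|interior B| - j) *: u]))
  /\
  (forall i j : nat, (1 <= i <= #|interior B|)%N -> (1 <= j <= i)%N ->
     interior_eigenvalue G B (i - j + 1) + degB_sorted G B j
       <= dirichlet_eigenvalue G B i
     /\ (dirichlet_eigenvalue G B i
           = interior_eigenvalue G B (i - j + 1) + degB_sorted G B j
         <-> exists u : rfun R (interior B),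
           [/\ u != 0,
               dirichlet_laplacian G u = dirichlet_eigenvalue G B i *: u,
               interior_laplacian G u = interior_eigenvalue G B (i - j + 1) *: u
             & degB_mul G u = degB_sorted G B j *: u])).
Proof.
have [ILS DMS DLE ILs DLs] := spectral_data G B.
have DMs := degB_mul_spectrum G B.
split=> i j /andP[i_gt0 i_le]; [move=> j_le|case/andP=> j_gt0 j_le].
(* [item1] is 1-based, hence the predecessors. With [n = #|interior B|], the index relation is [(i +
   j - 1) + (n - j - 1) + 1 = (i - 1) + n]. *)
- have [||||le_ eq_] := @weyl_upper _ _ (rdot G (B := B)) _ _ _ _ _ _
    (i + j).-1 (#|interior B| - j).-1 i.-1 ILS DMS DLE ILs DMs DLs;
    rewrite ?dim_rfun; [lia..|].
  by split=> //; rewrite -common_eigenvector_linfun.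
(* Here the 0-based positions satisfy [(i - j) + (j - 1) = i - 1]. *)
- have [||le_ eq_] := @weyl_lower _ _ (rdot G (B := B)) _ _ _ _ _ _
    (i - j + 1).-1 j.-1 i.-1 ILS DMS DLE ILs DMs DLs;
    rewrite ?dim_rfun; [lia..|].
  by split=> //; rewrite -common_eigenvector_linfun.
Qed.
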